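(* Let $(\mathcal R,\Lambda,S)$ be a generalized Renner-Coxeter system with group of units $W$, and let $\varepsilon\in\{+,-\}$. Then: (1) $(\mathcal R,\leq^{\varepsilon})$ is a partially ordered set. (2) $(W,\leq)$, with $\leq$ the Bruhat order, is a sub-partially ordered set of $(\mathcal R,\leq^{\varepsilon})$; i.e. for $u,v\in W$, $u\leq v$ iff $u\leq^{\varepsilon}v$. (3) $(\Lambda,\leq)$, with $e\leq f\Leftrightarrow ef=fe=e$, is a sub-partially ordered set of $(\mathcal R,\leq^{\varepsilon})$. (4) $(E(\mathcal R),\leq)$, with $e\leq f\Leftrightarrow ef=fe=e$, is a sub-partially ordered set of $(\mathcal R,\leq^{\varepsilon})$.
   Context: For a Coxeter system $(W,S)$, $\ell$ is the length function and $\leq$ the Bruhat order. For $I\subseteq S$, $W_I$ is the subgroup generated by $I$; $W^I$ (resp. ${}^IW$) is the set of $w\in W$ that are the Bruhat-minimum of $wW_I$ (resp. $W_Iw$). A generalized Renner-Coxeter system is a triple $(\mathcal R,\Lambda,S)$ such that: (i) $\mathcal R$ is a factorizable monoid with group of units $W$, i.e. $\mathcal R=E(\mathcal R)W=WE(\mathcal R)$, where the set $E(\mathcal R)$ of idempotents is a meet semilattice under $e\leq f\Leftrightarrow ef=fe=e$ (meet = product; thus $\mathcal R$ is an inverse monoid); (ii) $\Lambda$ is a transversal of $E(\mathcal R)$ for the conjugation action of $W$ and a sub-meet semilattice; (iii) $(W,S)$ is a Coxeter system; (iv) for every $e\leq e'$ in $E(\mathcal R)$ there are $w\in W$ and $f\leq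 f'$ in $\Lambda$ with $wew^{-1}=f$, $we'w^{-1}=f'$; (v) the map $\lambda^*(e)=\{s\in S\mid se=es\neq e\}$ on $\Lambda$ satisfies $e\leq f\Rightarrow\lambda^*(e)\subseteq\lambda^*(f)$; (vi) for every $e\in\Lambda$, $\{w\in W\mid we=ew\}$ and $\{w\in W\mid we=ew=e\}$ are standard parabolic subgroups of $W$. The subsets $\lambda(e),\lambda_*(e)\subseteq S$ are defined by $W_{\lambda(e)}=\{w\in W\mid we=ew\}$ and $W_{\lambda_*(e)}=\{w\in W\mid we=ew=e\}$. Each $r\in\mathcal R$ has a unique left standard form $r=xey$ with $e\in\Lambda$, $x\in W^{\lambda_*(e)}$, $y\in{}^{\lambda(e)}W$, and a unique right standard form $r=yex$ with $e\in\Lambda$, $y\in W^{\lambda(e)}$, $x\in{}^{\lambda_*(e)}W$. Adherence orders: if $r=xey$, $s=afb$ are in left standard form, $r\leq^{+}s$ iff $e\leq f$ and there is $w\in W_{\lambda^*(f)}W_{\lambda_*(e)}$ with $x\leq aw$ and $w^{-1}b\leq y$. If $r=yex$, $s=bfa$ are in right standard form, $r\leq^{-}s$ iff $e\leq f$ and there is $w\in W_{\lambda_*(e)}W_{\lambda^*(f)}$ with $x\leq wa$ and $bw^{-1}\leq y$. *)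

(* Defs.v *)
From HB Require Import structures.
From Stdlib Require Import Relations.
From mathcomp Require Import all_boot.
From mathcomp Require Import boolp classical_sets.

Set Implicit Arguments.
Unset Strict Implicit.
Unset Printing Implicit Defensive.

Local Open Scope classical_set_scope.
Local Open Scope group_scope.

(* The group of units of a monoid: a unit is packed with its (unique) two-sided
   inverse, so that the inverse operation is a swap. *)
Section Units.
Variable R : monoidType.

Definition mutually_inverse (p : R * R) : bool :=
  (p.1 * p.2 == 1) && (p.2 * p.1 == 1).

Record units := Units {
  unit_pair : (R * R)%type;
  _ : mutually_inverse unit_pair
}.

HB.instance Definition _ := [isSub for unit_pair].
HB.instance Definition _ := [Choice of units by <:].

Definition uval (u : units) : R := (unit_pair u).1.

Lemma units_one_subproof : mutually_inverse (1, 1).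
Proof. by rewrite /mutually_inverse /= mulg1 eqxx. Qed.

Lemma units_mul_subproof (u v : units) :
  mutually_inverse ((unit_pair u).1 * (unit_pair v).1,
                    (unit_pair v).2 * (unit_pair u).2).
Proof.
case: u v => [[a b] /andP[/= /eqP ab /eqP ba]] [[c d] /andP[/= /eqP cd /eqP dc]].
rewrite /mutually_inverse /=; apply/andP; split; apply/eqP.
  by rewrite -mulgA (mulgA c) cd mul1g.
by rewrite -mulgA (mulgA b) ba mul1g.
Qed.

Lemma units_inv_subproof (u : units) :
  mutually_inverse ((unit_pair u).2, (unit_pair u).1).
Proof. by case: u => [[a b]] /=; rewrite /mutually_inverse /= andbC. Qed.

Definition units_one : units := Units units_one_subproof.
Definition units_mul (u v : units) : units := Units (units_mul_subproof u v).
Definition units_inv (u : units) : units := Units (units_inv_subproof u).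

Lemma units_mulA : associative units_mul.
Proof. by move=> u v w; apply: val_inj; rewrite /= !mulgA. Qed.

Lemma units_mul1 : left_id units_one units_mul.
Proof. by case=> [[a b] h]; apply: val_inj; rewrite /= mul1g mulg1. Qed.

Lemma units_mulr1 : right_id units_one units_mul.
Proof. by case=> [[a b] h]; apply: val_inj; rewrite /= mul1g mulg1. Qed.

Lemma units_mulV : left_inverse units_one units_inv units_mul.
Proof.
case=> [[a b] h]; apply: val_inj => /=.
by case/andP: h => /= /eqP _ /eqP ->.
Qed.

Lemma units_mulrV : right_inverse units_one units_inv units_mul.
Proof.
case=> [[a b] h]; apply: val_inj => /=.
by case/andP: h => /= /eqP -> /eqP _.
Qed.

HB.instance Definition _ := isGroup.Build units
  units_mulA units_mul1 units_mulr1 units_mulV units_mulrV.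

End Units.



Section Coxeter.
Variables (W : groupType) (S : set W).
Implicit Types (I A B : set W) (w x y : W).

Definition word_in I (s : seq W) : Prop := forall x, x \in s -> I x.

Definition word_value (s : seq W) : W := \prod_(x <- s) x.

(* Coxeter matrices, with the value 0 standing for infinity. *)
Definition coxeter_matrix (m : W -> W -> nat) : Prop :=
  forall s t, S s -> S t -> m s t = m t s /\ (m s t = 1%N <-> s = t).

Definition coxeter_step (m : W -> W -> nat) (u v : seq W) : Prop :=
  exists (a b : seq W) (s t : W),
    [/\ S s, S t, u = a ++ flatten (nseq (m s t) [:: s; t]) ++ b
      & v = a ++ b].

(* W has the presentation < S | (s t)^(m s t) = 1, m s t finite >. Words use
   positive letters only: the relators s s for s in S make this the same as the
   group presentation. *)
Definition coxeter_system : Prop :=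
  exists m : W -> W -> nat,
    [/\ coxeter_matrix m,
        forall w, exists2 s, word_in S s & word_value s = w
      & forall u v, word_in S u -> word_in S v ->
          (word_value u = word_value v <->
           clos_refl_sym_trans (seq W) (coxeter_step m) u v)].

Definition has_word_of_size w (n : nat) : Prop :=
  exists s, [/\ word_in S s, word_value s = w & size s = n].

Definition cox_length w : nat :=
  xget 0%N [set n | has_word_of_size w n /\
                    forall k, has_word_of_size w k -> (n <= k)%N].

Definition reflection w : Prop := exists2 s, S s & exists x, w = x * s * x^-1.

Definition bruhat_step x y : Prop :=
  exists t, [/\ reflection t, y = x * t & (cox_length x < cox_length y)%N].

Definition bruhat : W -> W -> Prop := clos_refl_trans W bruhat_step.

Definition is_subgroup A : Prop :=
  A 1 /\ forall x y, A x -> A y -> A (x * y^-1).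

Definition gen I : set W := smallest is_subgroup I.

Definition standard_parabolic A : Prop := exists2 I, I `<=` S & A = gen I.

Definition bruhat_min A w : Prop := A w /\ forall x, A x -> bruhat w x.

Definition min_left I : set W := [set w | bruhat_min [set w * u | u in gen I] w].

Definition min_right I : set W := [set w | bruhat_min [set u * w | u in gen I] w].

Definition prod_set A B : set W := [set x * y | x in A & y in B].

End Coxeter.

Inductive sign := Plus | Minus.

Section RennerCoxeter.
Variables (R : monoidType) (Lam : set R) (S : set (units R)).
Implicit Types (e f r s : R) (w x y a b : units R).

Definition idempotents : set R := [set e | e * e = e].

Definition idem_le e f : Prop := e * f = e /\ f * e = e.

Definition conj_by w e : R := uval w * e * uval w^-1.

Definition idem_meet (A : set R) e f g : Prop :=
  [/\ A g, idem_le g e, idem_le g f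
    & forall h, A h -> idem_le h e -> idem_le h f -> idem_le h g].

Definition commuting_units e : set (units R) :=
  [set w : units R | uval w * e = e * uval w].

Definition fixing_units e : set (units R) :=
  [set w : units R | uval w * e = e * uval w /\ e * uval w = e].

Definition lambda_up e : set (units R) :=
  [set s : units R | [/\ S s, uval s * e = e * uval s & e * uval s <> e]].

(* lambda and lambda_down are the subsets I of S with gen I equal to the given
   set of units; such an I exists for e in Lam by the axioms below, and is
   unique since (W, S) is a Coxeter system. *)
Definition lambda e : set (units R) :=
  xget set0 [set I | I `<=` S /\ gen I = commuting_units e].

Definition lambda_down e : set (units R) :=
  xget set0 [set I | I `<=` S /\ gen I = fixing_units e].

Record generalized_renner_coxeter : Prop := {
  grc_factor_EW : forall r, exists2 e, idempotents e & exists w, r = e * uval w;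
  grc_factor_WE : forall r, exists2 e, idempotents e & exists w, r = uval w * e;
  grc_meet : forall e f, idempotents e -> idempotents f ->
    idem_meet idempotents e f (e * f);
  grc_Lam_idem : Lam `<=` idempotents;
  grc_transversal : forall e, idempotents e ->
    exists! f, Lam f /\ exists w, conj_by w e = f;
  grc_Lam_meet : forall e f, Lam e -> Lam f -> Lam (e * f);
  grc_coxeter : coxeter_system S;
  grc_conj_pairs : forall e e', idempotents e -> idempotents e' ->
    idem_le e e' ->
    exists w f f',
      [/\ Lam f, Lam f', idem_le f f', conj_by w e = f & conj_by w e' = f'];
  grc_lambda_up : forall e f, Lam e -> Lam f -> idem_le e f ->
    lambda_up e `<=` lambda_up f;
  grc_commuting : forall e, Lam e -> standard_parabolic S (commuting_units e);
  grc_fixing : forall e, Lam e -> standard_parabolic S (fixing_units e)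
}.

Definition left_standard_form r x e y : Prop :=
  [/\ r = uval x * e * uval y, Lam e, min_left S (lambda_down e) x
    & min_right S (lambda e) y].

Definition right_standard_form r y e x : Prop :=
  [/\ r = uval y * e * uval x, Lam e, min_left S (lambda e) y
    & min_right S (lambda_down e) x].

Definition adherence_plus r s : Prop :=
  exists x e y a f b,
    [/\ left_standard_form r x e y, left_standard_form s a f b, idem_le e f
      & exists w,
          [/\ prod_set (gen (lambda_up f)) (gen (lambda_down e)) w,
              bruhat S x (a * w) & bruhat S (w^-1 * b) y]].

Definition adherence_minus r s : Prop :=
  exists y e x b f a,
    [/\ right_standard_form r y e x, right_standard_form s b f a, idem_le e f
      & exists w,
          [/\ prod_set (gen (lambda_down e)) (gen (lambda_up f)) w,
              bruhat S x (w * a) & bruhat S (b * w^-1) y]].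

Definition adherence (eps : sign) : R -> R -> Prop :=
  match eps with Plus => adherence_plus | Minus => adherence_minus end.

End RennerCoxeter.

(* Main.v *)
(* The parity of the number of times a reflection t occurs among the reflections
   s_1 ... s_i ... s_1 attached to a word s_1 ... s_k is unchanged by the Coxeter
   relators, hence depends only on the value w of the word; it is odd exactly when
   tw is shorter than w.  This gives the exchange condition, the lifting property of
   the Bruhat order and minimal coset representatives.

   By uniqueness of standard forms both adherence orders are the same relation on
   triples (x, e, y).  For transitivity, let x <= a w1 w2 and (w1 w2)^-1 b <= y with w1
   in the group of lambda^*(f), w2 in that of lambda_*(e), and let a <= c v, v^-1 d <= b.
   Multiplying letter by letter along a reduced word of w1 gives w' in the same
   group with a w1 <= c v w' and w'^-1 v^-1 d <= w1^-1 b.  The factor w2 is absorbed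
   since x is minimal in its coset of the group of lambda_*(e), and one then corrects
   v w' by the element z of that group making z w'^-1 v^-1 d minimal.  The product
   v w' z^-1 has the required shape because the groups of lambda^*(f) and lambda_*(f)
   commute elementwise. *)
Require Import Defs.
From Stdlib Require Import Relations.
From mathcomp Require Import all_boot.
From mathcomp Require Import boolp classical_sets.

Set Implicit Arguments.
Unset Strict Implicit.
Unset Printing Implicit Defensive.

Local Open Scope classical_set_scope.
Local Open Scope group_scope.

(** * Words and generated subgroups *)

Section Words.
Variables (W : groupType) (S : set W).
Implicit Types (I : set W) (x y w s t r : W) (u v : seq W).

Lemma word_value_cons s u : word_value (s :: u) = s * word_value u.
Proof. by rewrite /word_value big_cons. Qed.

Lemma word_value_cat u v : word_value (u ++ v) = word_value u * word_value v.
Proof. by rewrite /word_value big_cat. Qed.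

Lemma word_value_nil : word_value [::] = 1 :> W.
Proof. by rewrite /word_value big_nil. Qed.

Lemma word_in_cons I s u : word_in I (s :: u) <-> I s /\ word_in I u.
Proof.
split=> [h|[hs hu] x]; last by rewrite inE => /orP[/eqP ->|/hu].
by split=> [|x xu]; apply: h; rewrite inE ?eqxx ?xu ?orbT.
Qed.

Lemma word_in_cat I u v : word_in I (u ++ v) <-> word_in I u /\ word_in I v.
Proof.
split=> [h|[hu hv] x]; last by rewrite mem_cat => /orP[/hu|/hv].
by split=> x xu; apply: h; rewrite mem_cat xu ?orbT.
Qed.

Lemma sub_word_in I u : I `<=` S -> word_in I u -> word_in S u.
Proof. by move=> IS Iu x /Iu/IS. Qed.

Lemma gen_sub I : I `<=` gen I.
Proof. by move=> x Ix A [_ IA]; apply: IA. Qed.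

Lemma gen_subgroup I : is_subgroup (gen I).
Proof.
split=> [A [[A1 _] _]//|x y gx gy A hA].
by have [[_ AM] _] := hA; apply: AM; [apply: gx|apply: gy].
Qed.

Lemma gen1 I : gen I 1.
Proof. by case: (gen_subgroup I). Qed.

Lemma genV I x : gen I x -> gen I x^-1.
Proof.
by case: (gen_subgroup I) => h1 hM gx; rewrite -[x^-1]mul1g; apply: hM.
Qed.

Lemma genM I x y : gen I x -> gen I y -> gen I (x * y).
Proof.
case: (gen_subgroup I) => h1 hM gx gy.
by rewrite -[y]invgK; apply: hM => //; apply: genV.
Qed.

Lemma gen_min I (A : set W) : is_subgroup A -> I `<=` A -> gen I `<=` A.
Proof. by move=> hA IA x; apply. Qed.

Lemma gen_word_value I u : word_in I u -> gen I (word_value u).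
Proof.
elim: u => [|s u IH]; first by rewrite word_value_nil => _; apply: gen1.
rewrite word_value_cons => /word_in_cons[Is /IH gu].
by apply: genM => //; apply: gen_sub.
Qed.

End Words.

(** * Exchange condition *)

(* [par u t] is the parity of the number of positions i in the word u = s_1 ... s_k
   with s_1 ... s_(i-1) s_i (s_1 ... s_(i-1))^-1 = t. *)
Fixpoint par (W : groupType) (u : seq W) (t : W) : bool :=
  if u is s :: u' then (s == t) (+) par u' (t ^ s) else false.

Section Parity.
Variables (W : groupType).
Implicit Types (s t r : W) (u v : seq W).

Lemma par_cat u v t : par (u ++ v) t = par u t (+) par v (t ^ word_value u).
Proof.
elim: u t => [|s u IH] t /=; first by rewrite word_value_nil conjg1.
by rewrite IH addbA word_value_cons conjgM.
Qed.

Lemma par_deletion u t : par u t ->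
  exists u1 s u2, u = u1 ++ s :: u2 /\ t = s ^ (word_value u1)^-1.
Proof.
elim: u t => [//|s u IH] t /=.
have [<- _|_ /=] := eqVneq s t.
  by exists [::], s, u; split=> //; rewrite word_value_nil invg1 conjg1.
case/IH => u1 [s' [u2 [-> h]]].
exists (s :: u1), s', u2; split=> //.
by rewrite word_value_cons invgM conjgM -h conjgK.
Qed.

(** Since [s] and [t] are involutions, [s * (s * t)^-1 = (s * t) * s], so conjugation by [s * t]
    shifts the exponent of the dihedral reflection [(s * t) ^+ i * s] by two. *)
Lemma dihedral_conj s t r i : s * s = 1 -> t * t = 1 ->
  (r ^ (s * t) == (s * t) ^+ i * s) = (r == (s * t) ^+ i.+2 * s).
Proof.
move=> ss tt; have sV : s^-1 = s by apply/(mulgI s); rewrite mulgV ss.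
have tV : t^-1 = t by apply/(mulgI t); rewrite mulgV tt.
have : s * (s * t)^-1 = (s * t) * s by rewrite invgM sV tV mulgA.
move: (s * t) => p sp; rewrite (can2_eq (conjgK _) (conjgKV _)); congr (_ == _).
by rewrite conjgE invgK -(mulgA (p ^+ i)) sp !mulgA -expgS -expgSr.
Qed.

Lemma par_dihedral s t r k : s * s = 1 -> t * t = 1 ->
  par (flatten (nseq k [:: s; t])) r
  = \big[addb/false]_(0 <= i < k.*2) (r == (s * t) ^+ i * s).
Proof.
move=> ss tt; elim: k r => [|k IH] r; first by rewrite big_geq.
rewrite /= -conjgM IH doubleS !big_nat_recl //; congr (_ (+) _).
  by rewrite expg0 mul1g eq_sym.
congr (_ (+) _); last by apply: eq_bigr => i _; rewrite dihedral_conj.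
rewrite eq_sym (can2_eq (conjgK _) (conjgKV _)) expg1; congr (_ == _).
have sV : s^-1 = s by apply/(mulgI s); rewrite mulgV ss.
by rewrite conjgE invgK sV !mulgA.
Qed.

Lemma par_relator s t r m : s * s = 1 -> t * t = 1 -> (s * t) ^+ m = 1 ->
  par (flatten (nseq m [:: s; t])) r = false.
Proof.
move=> ss tt stm; rewrite par_dihedral // -addnn.
(* As [(s * t) ^+ m = 1], the second half of the index range repeats the terms of the first, and the
   two halves cancel. *)
rewrite (@big_cat_nat _ _ _ m) ?leq_addr //= -{2}[m]add0n big_addn addnK.
under [X in _ (+) X]eq_bigr => i _ do rewrite expgnDr stm mulg1.
by rewrite addbb.
Qed.

Lemma word_value_relator s t m :
  word_value (flatten (nseq m [:: s; t])) = (s * t) ^+ m.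
Proof.
elim: m => [|m IH]; first by rewrite word_value_nil.
by rewrite /= !word_value_cons IH mulgA expgS.
Qed.

End Parity.

(** * Length function and left inversions *)

Section Length.
Variables (W : groupType) (S : set W).
Hypothesis cox : coxeter_system S.
Implicit Types (I : set W) (x y w s t r : W) (u v : seq W).

Local Notation len := (cox_length S).
Local Notation refl := (reflection S).

(** The diagonal entry [m s s] is 1, so the relator of the pair [s, s] is the two-letter word
    [s s]. *)
Lemma coxeter_invol s : S s -> s * s = 1.
Proof.
case: cox => m [mS _ hm] Ss.
have := word_value_relator s s (m s s); have [_ [_ ->]] := mS s s Ss Ss => //.
rewrite expg1 => <-; rewrite -[RHS]word_value_nil; apply/hm => //.
  by rewrite /= => x; rewrite !inE => /orP[] /eqP ->.
apply: rst_step; exists [::], [::], s, s; split=> //.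
by have [_ [_ ->]] := mS s s Ss Ss.
Qed.

Lemma coxeter_invV s : S s -> s^-1 = s.
Proof. by move=> /coxeter_invol ss; apply: (mulgI s); rewrite mulgV ss. Qed.

Lemma coxeter_involK s x : S s -> s * (s * x) = x.
Proof. by move=> Ss; rewrite mulgA coxeter_invol // mul1g. Qed.

Lemma par_word_value u v t : word_in S u -> word_in S v ->
  word_value u = word_value v -> par u t = par v t.
Proof.
case: cox => m [mS _ hm] Su Sv; rewrite hm // => {Su Sv} uv.
elim: uv t => {u v} [u v|//|u v _ IH t|u v w _ IH1 _ IH2 t].
- case=> a [b [s [r [Ss Sr -> ->]]]] t; rewrite !par_cat.
  have e : (s * r) ^+ m s r = 1.
    rewrite -word_value_relator -[RHS]word_value_nil; apply/hm => //.
      by move: (m s r); elim=> //= n IH; rewrite !word_in_cons.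
    by apply: rst_step; exists [::], [::], s, r; rewrite cats0.
  rewrite par_relator ?coxeter_invol // word_value_relator e conjg1.
  by rewrite addFb.
- by rewrite IH.
- by rewrite IH1 IH2.
Qed.

Lemma word_exists w : exists u, word_in S u /\ word_value u = w.
Proof. by case: cox => m [_ hw _]; have [u] := hw w; exists u. Qed.

Lemma gen_full w : gen S w.
Proof. by have [u [Su <-]] := word_exists w; apply: gen_word_value. Qed.

Lemma word_in_rev I u : word_in I u -> word_in I (rev u).
Proof. by move=> Iu x; rewrite mem_rev => /Iu. Qed.

Lemma word_value_rev u : word_in S u -> word_value (rev u) = (word_value u)^-1.
Proof.
elim: u => [|s u IH]; first by rewrite word_value_nil invg1.
case/word_in_cons=> Ss /IH h.
rewrite rev_cons -cats1 word_value_cat h !word_value_cons word_value_nil.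
by rewrite mulg1 invgM (coxeter_invV Ss).
Qed.

Lemma gen_word I w : I `<=` S -> gen I w ->
  exists u, word_in I u /\ word_value u = w.
Proof.
move=> IS; suff : gen I `<=` [set w | exists u, word_in I u /\ word_value u = w] by apply.
apply: gen_min.
- split=> [|x y [u [Iu <-]] [v [Iv <-]]]; first by exists [::]; rewrite word_value_nil.
  exists (u ++ rev v); split; first by apply/word_in_cat; split=> //; exact: word_in_rev.
  by rewrite word_value_cat word_value_rev //; apply: sub_word_in Iv.
- move=> s Is; exists [:: s]; split; first by apply/word_in_cons.
  by rewrite word_value_cons word_value_nil mulg1.
Qed.

Lemma has_least_nat (P : nat -> Prop) :
  (exists n, P n) -> exists n, P n /\ forall k, P k -> (n <= k)%N.
Proof.
move=> [n Pn]; have ex : exists n, `[< P n >] by exists n; apply/asboolP.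
exists (ex_minn ex); case: ex_minnP => m /asboolP Pm h; split=> // k Pk.
by apply: h; apply/asboolP.
Qed.

Lemma cox_lengthP w :
  has_word_of_size S w (len w) /\
  forall k, has_word_of_size S w k -> (len w <= k)%N.
Proof.
rewrite /cox_length; case: xgetP => [n _ //|h].
have [|n hn] := @has_least_nat (has_word_of_size S w); last by case: (h n).
by have [u [Su <-]] := word_exists w; exists (size u), u.
Qed.

Lemma reduced_word w : exists u, [/\ word_in S u, word_value u = w & size u = len w].
Proof. by case: (cox_lengthP w). Qed.

Lemma cox_length_word u : word_in S u -> (len (word_value u) <= size u)%N.
Proof. by move=> Su; case: (cox_lengthP (word_value u)) => _; apply; exists u. Qed.

Lemma cox_length1 : len 1 = 0%N.
Proof.
by apply/eqP; rewrite -leqn0 -(word_value_nil W); apply: (@cox_length_word [::]).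
Qed.

Lemma cox_length_mul_gen s w : S s -> (len (s * w) <= (len w).+1)%N.
Proof.
move=> Ss; have [u [Su <- <-]] := reduced_word w.
by rewrite -word_value_cons; apply: (@cox_length_word (s :: u)); apply/word_in_cons.
Qed.

Lemma cox_lengthV w : len w^-1 = len w.
Proof.
suff h x : (len x^-1 <= len x)%N.
  by apply/eqP; rewrite eqn_leq h -{1}[w]invgK h.
have [u [Su <- <-]] := reduced_word x.
rewrite -word_value_rev // -size_rev; apply: cox_length_word.
exact: word_in_rev.
Qed.

(** On reflections this is the indicator of the left inversions of [w]. The chosen word is
    immaterial by [par_word_value], and the default is never reached because [S] generates. *)
Definition parW w t : bool :=
  par (xget [::] [set u | word_in S u /\ word_value u = w]) t.

Lemma parW_word u t : word_in S u -> parW (word_value u) t = par u t.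
Proof.
rewrite /parW => Su; case: xgetP => [v _ [Sv e]|/(_ u)[]//].
exact: par_word_value.
Qed.

Lemma parWM x y t : parW (x * y) t = parW x t (+) parW y (t ^ x).
Proof.
have [u [Su <-]] := word_exists x; have [v [Sv <-]] := word_exists y.
rewrite -word_value_cat !parW_word ?par_cat //.
by apply/word_in_cat.
Qed.

Lemma parW1 t : parW 1 t = false.
Proof. by rewrite -(word_value_nil W) parW_word. Qed.

Lemma parW_gen s t : S s -> parW s t = (s == t).
Proof.
move=> Ss; have {1}-> : s = word_value [:: s].
  by rewrite word_value_cons word_value_nil mulg1.
by rewrite parW_word /= ?addbF //; apply/word_in_cons.
Qed.

Lemma reflection_gen s : S s -> refl s.
Proof. by move=> Ss; exists s => //; exists 1; rewrite mul1g invg1 mulg1. Qed.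

Lemma reflection_conj t x : refl t -> refl (t ^ x).
Proof.
case=> s Ss [y ->]; exists s => //; exists (x^-1 * y).
by rewrite conjgE invgM invgK !mulgA.
Qed.

Lemma reflection_invol t x : refl t -> t * (t * x) = x.
Proof.
case=> s Ss [y ->]; rewrite mulgA; have ss := coxeter_invol Ss.
by rewrite -!mulgA mulKg (mulgA s) ss mul1g mulVKg.
Qed.

(** Write [t = x * s * x^-1]. By the cocycle rule [parWM], the contributions of [x] and [x^-1] add
    up to [parW S 1 t], which is false, and only that of [s] remains. *)
Lemma parW_refl t : refl t -> parW t t.
Proof.
case=> s Ss [x et].
have e1 : t ^ x = s by rewrite et conjgE mulgVK mulKg.
have e2 : t ^ (x * s) = s by rewrite conjgM e1 conjgE mulKg.
rewrite {1}et !parWM e1 e2 (parW_gen _ Ss) eqxx.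
have := parW1 t; rewrite -(mulgV x) parWM e1 => /eqP.
by case: (parW x t); case: (parW x^-1 s).
Qed.

Lemma parW_length_lt t w : parW w t -> (len (t * w) < len w)%N.
Proof.
have [u [Su <- <-]] := reduced_word w.
rewrite parW_word // => /par_deletion[u1 [s [u2 [eu et]]]].
move: Su; rewrite eu => /word_in_cat[S1 /word_in_cons[Ss S2]].
have -> : t * word_value (u1 ++ s :: u2) = word_value (u1 ++ u2).
  rewrite et conjgE invgK !word_value_cat word_value_cons !mulgA mulgVK.
  by rewrite -(mulgA _ s s) coxeter_invol // mulg1.
apply: leq_ltn_trans (cox_length_word _) _; first exact/word_in_cat.
by rewrite !size_cat /= addnS.
Qed.

(** If [parW w t] fails, then [t] has odd parity in [t * w], so deletion makes [w = t * (t * w)]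
    shorter than [t * w]. *)
Lemma cox_length_reflection t w : refl t -> (len (t * w) < len w)%N = parW w t.
Proof.
move=> rt; apply/idP/idP => [lt|]; last exact: parW_length_lt.
apply/negPn/negP => n.
have : parW (t * w) t.
  by rewrite parWM parW_refl // conjgE mulKg (negbTE n).
by move/parW_length_lt; rewrite reflection_invol // ltnNge (ltnW lt).
Qed.

Lemma cox_length_reflection_gt t w : refl t -> (len w < len (t * w))%N = ~~ parW w t.
Proof.
move=> rt; rewrite -{1}(reflection_invol w rt) cox_length_reflection // parWM.
by rewrite parW_refl // conjgE mulKg.
Qed.

End Length.

(** * Bruhat order *)

Section Bruhat.
Variables (W : groupType) (S : set W).
Hypothesis cox : coxeter_system S.
Implicit Types (I : set W) (x y w s t r p q : W) (u v : seq W).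

Local Notation len := (cox_length S).
Local Notation refl := (reflection S).
Local Notation bru := (bruhat S).
Local Notation step := (bruhat_step S).

Lemma bruhat_refl x : bru x x.
Proof. exact: rt_refl. Qed.

Lemma bruhat_trans y x z : bru x y -> bru y z -> bru x z.
Proof. exact: rt_trans. Qed.

Lemma bruhat_length x y : bru x y -> x = y \/ (len x < len y)%N.
Proof.
elim=> {x y} [x y [t [_ _ ?]]|x|x y z _ [->|h1] _ [<-|h2]]; try by [left|right].
by right; apply: ltn_trans h2.
Qed.

Lemma bruhat_anti x y : bru x y -> bru y x -> x = y.
Proof.
move=> /bruhat_length[//|h1] /bruhat_length[//|h2].
by have := ltn_trans h1 h2; rewrite ltnn.
Qed.

(** Conjugation by [x] moves the reflection from the right to the left, where [parW] detects the
    change of length. *)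
Lemma bruhat_stepP x y :
  step x y <-> exists t, [/\ refl t, y = t * x & ~~ parW S x t].
Proof.
split=> [[t [rt -> lt]]|[t [rt -> lt]]].
  exists (t ^ x^-1); have rt' := reflection_conj x^-1 rt.
  have e : t ^ x^-1 * x = x * t by rewrite conjgE invgK mulgA mulgVK.
  by rewrite -cox_length_reflection_gt // e.
exists (t ^ x); rewrite cox_length_reflection_gt // lt conjgE mulVKg.
by split=> //; apply: reflection_conj.
Qed.

Lemma bruhatV x y : bru x y -> bru x^-1 y^-1.
Proof.
elim=> {x y} [x y|x|x y z _ h1 _]; [|exact: bruhat_refl|exact: bruhat_trans].
move/bruhat_stepP => [t [rt -> lt]]; apply: rt_step; exists t; split=> //.
  by rewrite invgM -[t^-1]mulg1 -[in LHS](reflection_invol cox 1 rt) mulKg mulg1.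
by rewrite !(cox_lengthV cox) cox_length_reflection_gt.
Qed.

(** The step is transported by the reflection [t ^ s]. The extra letter [s] would alter the parity
    only if [t ^ s = s], that is, [t = s]. *)
Lemma bruhat_step_mul s x t : S s -> refl t -> ~~ parW S x t -> s <> t ->
  step (s * x) (s * (t * x)).
Proof.
move=> Ss rt lt /eqP st; apply/bruhat_stepP; exists (t ^ s); split.
- exact: reflection_conj.
- by rewrite conjgE (coxeter_invV cox Ss) -!mulgA (coxeter_involK cox _ Ss).
- have -> : parW S (s * x) (t ^ s) = (s == t ^ s) (+) parW S x ((t ^ s) ^ s).
    by rewrite parWM // parW_gen.
  rewrite -conjgM (coxeter_invol cox Ss) conjg1 (negbTE lt) addbF.
  rewrite eq_sym (can2_eq (conjgK _) (conjgKV _)) conjgE invgK mulgV mulg1.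
  by rewrite eq_sym.
Qed.

(** Along a chain from [x] to [y], left multiplication by [s] carries over every step except one
    with [t = s]; there [s * x] is itself the next element of the chain. *)
Lemma bruhat_mull s x y : S s -> bru x y ->
  bru (s * x) (s * y) \/ bru (s * x) y.
Proof.
move=> Ss; move: x.
apply: clos_refl_trans_ind_right => [|x x1 /bruhat_stepP[t [rt -> lt]] IH xy].
  by left; apply: bruhat_refl.
have [->|/eqP st] := eqVneq s t; first by right.
have h := rt_step _ _ _ _ (bruhat_step_mul Ss rt lt st).
by case: IH => h'; [left|right]; apply: bruhat_trans h'.
Qed.

Lemma bruhat_lift s x y : S s -> bru x y -> bru x (s * y) \/ bru (s * x) (s * y).
Proof.
move=> Ss; move: x.
apply: clos_refl_trans_ind_right => [|x x1 xx1 IH xy].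
  by right; apply: bruhat_refl.
have bx : bru x x1 by apply: rt_step.
case: IH => [h|]; first by left; apply: bruhat_trans h.
move/bruhat_stepP: xx1 => [t [rt -> lt]].
have [<-|/eqP st] := eqVneq s t; first by rewrite (coxeter_involK cox _ Ss) => h; left.
move=> h; right; apply: bruhat_trans h.
exact: rt_step (bruhat_step_mul Ss rt lt st).
Qed.

Lemma bruhat_mulr s x y : S s -> bru x y ->
  bru (x * s) (y * s) \/ bru (x * s) y.
Proof.
move=> Ss /bruhatV /(bruhat_mull Ss) [] /bruhatV; rewrite !invgM !invgK (coxeter_invV cox Ss);
  by [left|right].
Qed.

End Bruhat.

(** * Minimal coset representatives *)

Section Cosets.
Variables (W : groupType) (S I : set W).
Hypotheses (cox : coxeter_system S) (IS : I `<=` S).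
Implicit Types (x y w s t r p q a b : W) (u v : seq W).

Local Notation len := (cox_length S).
Local Notation bru := (bruhat S).

Lemma min_rightP p :
  min_right S I p <-> forall x, gen I x -> bru p (x * p).
Proof.
split=> [[_ h] x gx|h]; first by apply: h; exists x.
split=> [|_ [x gx <-]]; last exact: h.
by exists 1; rewrite ?mul1g //; apply: gen1.
Qed.

Lemma min_leftP p : min_left S I p <-> forall x, gen I x -> bru p (p * x).
Proof.
split=> [[_ h] x gx|h]; first by apply: h; exists x.
split=> [|_ [x gx <-]]; last exact: h.
by exists 1; rewrite ?mulg1 //; apply: gen1.
Qed.

Lemma min_leftV p : min_left S I p <-> min_right S I p^-1.
Proof.
rewrite min_leftP min_rightP; split=> h x /genV gx.
  by rewrite -[x]invgK -invgM; apply: bruhatV => //; apply: h.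
rewrite -[p]invgK -[x]invgK -invgM; apply: bruhatV => //; exact: h.
Qed.

Lemma min_right_uniq p x : min_right S I p -> min_right S I (x * p) -> gen I x ->
  x = 1.
Proof.
move=> /min_rightP mp /min_rightP mxp gx; apply: (mulIg p); rewrite mul1g.
apply: (@bruhat_anti _ S); last exact: mp.
by rewrite -{2}[p](mulKg x); apply: mxp; apply: genV.
Qed.

(** The letters of [x] are put on one at a time by the lifting property; its second alternative
    [s * p <= s * q'] suffices because [p <= s * p] by minimality. *)
Lemma min_right_le_mul p q x : min_right S I p -> bru p q -> gen I x ->
  bru p (x * q).
Proof.
move=> /min_rightP mp pq /(gen_word cox IS)[u [Iu <-]].
elim: u Iu => [_|s u IH /word_in_cons[Is /IH h]].
  by rewrite word_value_nil mul1g.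
rewrite word_value_cons -mulgA.
have [//|sp] := bruhat_lift cox (IS Is) h.
by apply: bruhat_trans sp; apply: mp; apply: gen_sub.
Qed.

(** Minimality is among words in [I] only; agreement with the length for [S] is the case [p = 1] of
    [length_reduced_in]. *)
Definition reduced_in u : Prop :=
  word_in I u /\
  forall v, word_in I v -> word_value v = word_value u -> (size u <= size v)%N.

Lemma reduced_in_exists x : gen I x -> exists u, reduced_in u /\ word_value u = x.
Proof.
move=> /(gen_word cox IS)[u [Iu <-]].
have [|n [[v [Iv <- e]] h]] := @has_least_nat (fun n => exists v,
    [/\ word_in I v, size v = n & word_value v = word_value u]).
  by exists (size u), u.
exists v; split=> //; split=> // v' Iv' ev'; apply: h.
by exists v'; rewrite ev'.
Qed.

Lemma reduced_in_cons s u : reduced_in (s :: u) -> reduced_in u.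
Proof.
move=> [/word_in_cons[Is Iu] h]; split=> // v Iv ev.
have := h (s :: v); rewrite !word_value_cons ev ltnS; apply=> //.
exact/word_in_cons.
Qed.

(** Otherwise, by the cocycle rule, either [s] is a reflection of [u], and deleting a letter gives a
    shorter word in [I] for [s :: u], or the conjugate of [s] by [u], which lies in [gen I],
    shortens [p]. *)
Lemma parW_reduced_in p s u : (forall x, gen I x -> (len p <= len (x * p))%N) ->
  reduced_in (s :: u) -> ~~ parW S (word_value u * p) s.
Proof.
move=> mp [/word_in_cons[Is Iu] red]; apply/negP.
have Su : word_in S u by apply: sub_word_in Iu.
rewrite parWM // parW_word //.
have [/par_deletion[u1 [s' [u2 [eu es]]]] _|_ /=] := boolP (par u s).
  move: Iu Su; rewrite eu => /word_in_cat[I1 /word_in_cons[_ I2]].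
  move=> /word_in_cat[_ /word_in_cons[Ss' _]].
  have := red (u1 ++ u2); rewrite eu word_value_cons /= !size_cat /=.
  rewrite addnS ltnNge leqW ?leqnn // => h; suff: false by []; apply: h.
    exact/word_in_cat.
  rewrite es conjgE invgK !word_value_cat word_value_cons !mulgA mulgVK.
  by rewrite -(mulgA _ s' s') (coxeter_invol cox Ss') mulg1.
move/(parW_length_lt cox); rewrite ltnNge mp //.
have gu := gen_word_value Iu.
by rewrite conjgE; do 2?[apply: genM => //]; [apply: genV|apply: gen_sub].
Qed.

Lemma bruhat_reduced_in p s u : (forall x, gen I x -> (len p <= len (x * p))%N) ->
  reduced_in (s :: u) -> bru (word_value u * p) (s * (word_value u * p)).
Proof.
move=> mp red; have Is : I s by case: red => /word_in_cons[].
apply: rt_step; apply/(bruhat_stepP cox); exists s.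
by rewrite parW_reduced_in //; split=> //; apply: reflection_gen; apply: IS.
Qed.

Lemma length_reduced_in p u : (forall x, gen I x -> (len p <= len (x * p))%N) ->
  reduced_in u -> (size u + len p <= len (word_value u * p))%N.
Proof.
move=> mp; elim: u => [|s u IH] red; first by rewrite word_value_nil mul1g.
apply: leq_ltn_trans (IH (reduced_in_cons red)) _.
rewrite word_value_cons -mulgA cox_length_reflection_gt ?parW_reduced_in //.
by apply: reflection_gen; apply: IS; case: red => /word_in_cons[].
Qed.

Lemma min_right_length p :
  (forall x, gen I x -> (len p <= len (x * p))%N) <-> min_right S I p.
Proof.
split=> [mp|/min_rightP mp x /mp/bruhat_length[<- //|/ltnW //]].
apply/min_rightP => _ /reduced_in_exists[u [red <-]].
elim: u red => [_|s u IH red].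
  by rewrite word_value_nil mul1g; apply: bruhat_refl.
rewrite word_value_cons -mulgA.
apply: bruhat_trans (IH (reduced_in_cons red)) _.
exact: bruhat_reduced_in.
Qed.

Lemma min_right1 : min_right S I 1.
Proof. by apply/min_right_length => x _; rewrite cox_length1. Qed.

Lemma min_right_exists q : exists x, gen I x /\ min_right S I (x * q).
Proof.
have [|n [[x gx <-] h]] := @has_least_nat (fun n => exists2 x, gen I x & len (x * q) = n).
  by exists (len (1 * q)), 1 => //; apply: gen1.
exists x; split=> //; apply/min_right_length => y gy; apply: h.
by exists (y * x); rewrite ?mulgA //; apply: genM.
Qed.

(** The induction follows a reduced word of [w^-1], so by minimality of [b] each new letter [s]
    raises [w^-1 * b]. The letter is appended to [w'] or skipped according to the two alternatives
    of [bruhat_mulr]. *)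
Lemma bruhat_mul_twist a a' b b' w : min_right S I b -> bru a a' -> bru b' b ->
  gen I w ->
  exists w', [/\ gen I w', bru (a * w) (a' * w') & bru (w'^-1 * b') (w^-1 * b)].
Proof.
move=> /min_right_length mb aa bb /genV /reduced_in_exists[u [red eu]].
rewrite -[w]invgK -{}eu invgK.
elim: u red => [_|s u IH red].
  by exists 1; rewrite word_value_nil invg1 !mulg1 !mul1g; split=> //; apply: gen1.
have Is : I s by case: red => /word_in_cons[].
have Ss := IS Is; have sV := coxeter_invV cox Ss.
have [w' [gw' aw bw]] := IH (reduced_in_cons red).
have grow := bruhat_reduced_in mb red.
rewrite !word_value_cons invgM sV !mulgA -(mulgA s).
case: (bruhat_mulr cox Ss aw) => h; last first.
  by exists w'; split=> //; apply: bruhat_trans grow.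
exists (w' * s); split; first by apply: genM => //; apply: gen_sub.
  by rewrite mulgA.
rewrite invgM sV -mulgA.
case: (bruhat_mull cox Ss bw) => // h'; exact: bruhat_trans grow.
Qed.

(** As [s] is the shortest element of its coset, a reduced word [v] in [I] for [s * t * s] satisfies
    [size v + 1 <= len (s * t) <= 2]. Hence [s * t * s] is trivial or a single letter [r]. *)
Lemma gen_conj_commute s t : S s -> S t -> ~ gen I s -> gen I t ->
  gen I (s * t * s) -> s * t = t * s.
Proof.
move=> Ss St ns gt /reduced_in_exists[v [red ev]].
have ss := coxeter_invol cox Ss.
have ls : len s = 1%N.
  apply/eqP; rewrite eqn_leq; apply/andP; split.
    by rewrite -[s]mulg1 (leq_trans (cox_length_mul_gen cox _ Ss)) ?cox_length1.
  have [[|x w] [_ e <-]] // := reduced_word cox s.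
  by case: ns; rewrite -e word_value_nil; apply: gen1.
have mp x : gen I x -> (len s <= len (x * s))%N.
  move=> gx; rewrite ls; have [[|y w] [_ e <-]] // := reduced_word cox (x * s).
  case: ns; rewrite -[s](mulKg x) -e word_value_nil mulg1; exact: genV.
have := length_reduced_in mp red.
rewrite ev -(mulgA _ s s) ss mulg1 ls addn1 => lv.
have l2 : (len (s * t) <= 2)%N.
  apply: leq_trans (cox_length_mul_gen cox _ Ss) _; rewrite ltnS -[t]mulg1.
  by rewrite (leq_trans (cox_length_mul_gen cox _ St)) ?cox_length1.
have {lv l2} := leq_trans lv l2; rewrite ltnS.
case: v red ev => [|r [|//]] [Iv _] ev _.
  move: ev; rewrite word_value_nil => /esym e.
  have -> : t = 1; last by rewrite mulg1 mul1g.
  by apply: (mulgI s); apply: (mulIg s); rewrite e mulg1.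
have Ir : I r by case/word_in_cons: Iv.
move: ev; rewrite word_value_cons word_value_nil mulg1 => er.
have ers : r * s = s * t by rewrite er -mulgA ss mulg1.
have nr : (r == s) = false by apply/eqP => e; apply: ns; rewrite -e; apply: gen_sub.
have nt : (t == s) = false by apply/eqP => e; apply: ns; rewrite -e.
(* The left inversion [s] of [s * t = r * s] can come only from the last letter of [r * s], which
   forces [s ^ r = s]. *)
have p1 : parW S (s * t) s.
  rewrite parWM // (parW_gen cox _ Ss) (parW_gen cox _ St) eqxx conjgE mulKg nt.
  by [].
move: p1; rewrite -ers parWM // (parW_gen cox _ Ss) (parW_gen cox _ (IS Ir)) nr /=.
move=> /eqP e.
have rs : r * s = s * r by rewrite {1}e conjgE mulVKg.
by have -> : t = r by apply: (mulgI s); rewrite -ers.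
Qed.

End Cosets.

Lemma gen_commute (W : groupType) (A B : set W) :
  (forall x y, A x -> B y -> x * y = y * x) ->
  forall x y, gen A x -> gen B y -> x * y = y * x.
Proof.
move=> AB.
have cent (D : set W) : is_subgroup [set x | forall y, D y -> x * y = y * x].
  split=> [y _|x z hx hz y Dy]; first by rewrite mulg1 mul1g.
  have zy : z^-1 * y = y * z^-1.
    by apply: (mulgI z); rewrite mulVKg mulgA hz // mulgK.
  by rewrite -mulgA zy !mulgA hx.
have h : gen A `<=` [set x | forall y, B y -> x * y = y * x].
  by apply: gen_min => // x Ax y; apply: AB.
move=> x y gx; move: y; suff h' : gen B `<=` [set y | forall x, gen A x -> y * x = x * y].
  by move=> y /h' ->.
by apply: gen_min => // y By z /h ->.
Qed.

Section LeftCosets.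
Variables (W : groupType) (S I : set W).
Hypotheses (cox : coxeter_system S) (IS : I `<=` S).
Implicit Types (x p q : W).

Lemma min_left_le_mul p q x : min_left S I p -> bruhat S p q -> gen I x ->
  bruhat S p (q * x).
Proof.
move=> /(min_leftV I cox) mp /(bruhatV cox) pq gx.
rewrite -[p]invgK -[q * x]invgK invgM; apply: bruhatV => //.
by apply: min_right_le_mul mp pq _ => //; apply: genV.
Qed.

Lemma min_left_exists q : exists x, gen I x /\ min_left S I (q * x).
Proof.
have [x [gx mx]] := min_right_exists cox IS q^-1.
exists x^-1; split; first exact: genV.
by apply/(min_leftV I cox); rewrite invgM invgK.
Qed.

Lemma min_left_uniq p x : min_left S I p -> min_left S I (p * x) -> gen I x ->
  x = 1.
Proof.
move=> /(min_leftV I cox) mp /(min_leftV I cox); rewrite invgM => mpx gx.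
by apply: (can_inj invgK); rewrite invg1; apply: min_right_uniq mp mpx _; apply: genV.
Qed.

End LeftCosets.

(** * Standard forms and adherence orders *)

Section UnitsAndIdempotents.
Variables (R : monoidType).
Implicit Types (e f : R) (u w : units R).

Lemma uvalM u w : uval (u * w) = uval u * uval w.
Proof. by []. Qed.

Lemma uval1 : uval 1 = 1 :> R.
Proof. by []. Qed.

Lemma uval_inj : injective (@uval R).
Proof.
move=> [[a b] hu] [[c d] hv] ac; apply: val_inj; rewrite /uval /= in ac *.
subst c; case/andP: hu => /= _ /eqP ba; case/andP: hv => /= /eqP ad _.
by rewrite -[b]mulg1 -ad mulgA ba mul1g.
Qed.

Lemma uvalK u (r : R) : uval u * (uval u^-1 * r) = r.
Proof. by rewrite mulgA -uvalM mulgV mul1g. Qed.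

Lemma uvalVK u (r : R) : uval u^-1 * (uval u * r) = r.
Proof. by rewrite mulgA -uvalM mulVg mul1g. Qed.

Lemma conj_by_idem e u : idempotents e -> idempotents (conj_by u e).
Proof.
rewrite /idempotents /conj_by /= => ee.
by rewrite -!mulgA uvalVK (mulgA e e) ee.
Qed.

Lemma conj_byK e f u : conj_by u e = f -> e = uval u^-1 * f * uval u.
Proof.
move=> <-; rewrite /conj_by -!mulgA uvalVK.
by rewrite -uvalM mulVg uval1 mulg1.
Qed.

Lemma commuting_conj e u : commuting_units e u <-> conj_by u e = e.
Proof.
rewrite /commuting_units /conj_by /=; split=> [->|h].
  by rewrite -mulgA -uvalM mulgV uval1 mulg1.
by rewrite -{2}h -mulgA -uvalM mulVg uval1 mulg1.
Qed.

End UnitsAndIdempotents.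

(** * Idempotents, double cosets and the parabolic subgroups attached to [e] *)

Section RennerCoxeter.
Variables (R : monoidType) (Lam : set R) (S : set (units R)).
Hypothesis grc : generalized_renner_coxeter Lam S.
Implicit Types (e f r s : R) (u v w x y a b : units R).

Let cox : coxeter_system S := grc_coxeter grc.

Lemma idem_comm e f : idempotents e -> idempotents f -> e * f = f * e.
Proof.
move=> ie jf; have [iEF [ef1 ef2] [ef3 ef4] hef] := grc_meet grc ie jf.
have [iFE fe1 fe2 hfe] := grc_meet grc jf ie.
have [h1 _] := hef _ iFE fe2 fe1.
have [_ h2] := hfe _ iEF (conj ef3 ef4) (conj ef1 ef2).
by rewrite -h1 h2.
Qed.

(** From [e * uval u^-1 = e] the product [uval u^-1 * e] is idempotent; it commutes with [e], which
    makes it equal to [e]. *)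
Lemma idem_fix e u : idempotents e -> e * uval u = e -> uval u * e = e.
Proof.
move=> ie eu.
have euV : e * uval u^-1 = e by rewrite -{1}eu -mulgA -uvalM mulgV uval1 mulg1.
have ig : idempotents (uval u^-1 * e).
  by rewrite /idempotents /= -mulgA (mulgA e) euV ie.
have := idem_comm ie ig; rewrite mulgA euV ie => h.
by rewrite {1}h -!mulgA ie uvalK.
Qed.

Lemma Lam_idem e : Lam e -> idempotents e.
Proof. exact: (grc_Lam_idem grc). Qed.

Lemma Lam_conj_eq e f w : Lam e -> Lam f -> conj_by w e = f -> e = f.
Proof.
move=> Le Lf ef; have [g [_ uniq]] := grc_transversal grc (Lam_idem Le).
rewrite -(uniq e) ?(uniq f) //; first by split=> //; exists w.
by split=> //; exists 1; apply/commuting_conj; rewrite /commuting_units /= mul1g mulg1.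
Qed.

(** After cancelling, [e] is the idempotent [conj_by w e'] times a unit, and conversely. So each of
    these commuting idempotents absorbs the other, they coincide, and the transversal gives
    [e = e']. *)
Lemma double_coset_uniq u e v u' e' v' : Lam e -> Lam e' ->
  uval u * e * uval v = uval u' * e' * uval v' ->
  [/\ e = e', commuting_units e (u^-1 * u')
    & fixing_units e (u^-1 * u' * (v' * v^-1))].
Proof.
move=> Le Le' h; have ie := Lam_idem Le; have ie' := Lam_idem Le'.
have {}h : e = uval (u^-1 * u') * e' * uval (v' * v^-1).
  have -> : e = uval u^-1 * (uval u * e * uval v) * uval v^-1.
    by rewrite -!mulgA uvalVK -uvalM mulgV uval1 mulg1.
  by rewrite h !uvalM !mulgA.
move: (u^-1 * u') (v' * v^-1) h => w z h.
have iff := conj_by_idem w ie'.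
have ef : e = conj_by w e' * uval (w * z).
  by rewrite /conj_by uvalM -!mulgA uvalVK mulgA.
have fe : conj_by w e' * e = e by rewrite {1}ef mulgA iff -ef.
have ef' : e * uval (w * z)^-1 = conj_by w e'.
  by rewrite {1}ef -mulgA -uvalM mulgV uval1 mulg1.
have eqf : conj_by w e' = e.
  by rewrite -fe (idem_comm iff ie) -{2}ef' mulgA ie ef'.
have ee' : e' = e by apply: Lam_conj_eq eqf.
subst e'; split=> //; first exact/commuting_conj.
have fx : e * uval (w * z) = e by rewrite -{1}eqf -ef.
by split=> //; rewrite fx; apply: idem_fix.
Qed.

Lemma fixing_commuting e w : fixing_units e w -> commuting_units e w.
Proof. by case. Qed.

Lemma lambdaP e : Lam e -> lambda S e `<=` S /\ gen (lambda S e) = commuting_units e.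
Proof.
move=> /(grc_commuting grc)[I IS eI].
by rewrite /lambda; case: xgetP => [J _ //|/(_ I)[]].
Qed.

Lemma lambda_downP e : Lam e ->
  lambda_down S e `<=` S /\ gen (lambda_down S e) = fixing_units e.
Proof.
move=> /(grc_fixing grc)[I IS eI].
by rewrite /lambda_down; case: xgetP => [J _ //|/(_ I)[]].
Qed.

Lemma gen_lambdaE e : Lam e -> gen (lambda S e) = commuting_units e.
Proof. by case/lambdaP. Qed.

Lemma gen_lambda_downE e : Lam e -> gen (lambda_down S e) = fixing_units e.
Proof. by case/lambda_downP. Qed.

Lemma lambda_sub e : Lam e -> lambda S e `<=` S.
Proof. by case/lambdaP. Qed.

Lemma lambda_down_sub e : Lam e -> lambda_down S e `<=` S.
Proof. by case/lambda_downP. Qed.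

Lemma lambda_up_sub e : lambda_up S e `<=` S.
Proof. by move=> s []. Qed.

Lemma gen_lambda_up_commuting e w : Lam e -> gen (lambda_up S e) w -> commuting_units e w.
Proof.
move=> Le; suff h : gen (lambda_up S e) `<=` gen (lambda S e).
  by rewrite -gen_lambdaE // => /h.
apply: gen_min; first exact: gen_subgroup.
by move=> s [Ss se _]; rewrite gen_lambdaE.
Qed.

(** A generator [s] of the first group commutes with [e] without fixing it, so it lies outside the
    fixing group but normalizes it; [gen_conj_commute] then applies to each pair of generators. *)
Lemma lambda_up_down_commute e x y : Lam e ->
  gen (lambda_up S e) x -> gen (lambda_down S e) y -> x * y = y * x.
Proof.
move=> Le; apply: gen_commute => {x y} s t [Ss se nse] It.
have ft : fixing_units e t by rewrite -gen_lambda_downE //; apply: gen_sub.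
have St := lambda_down_sub Le It.
apply: (gen_conj_commute cox (lambda_down_sub Le)) => //.
- by rewrite gen_lambda_downE // => -[_ /nse].
- exact: gen_sub.
case: ft => te et; rewrite gen_lambda_downE //.
have est : e * uval (s * t * s) = e.
  rewrite !uvalM !mulgA -se -(mulgA _ e) et se -mulgA -uvalM.
  by rewrite (coxeter_invol cox Ss) uval1 mulg1.
by split=> //; rewrite est; apply: idem_fix => //; apply: Lam_idem.
Qed.

(** The two groups commute, so the products form a subgroup; it contains each [s] in [lambda S e],
    on one side or the other according to whether [e * uval s = e]. *)
Lemma commuting_decomp e w : Lam e -> commuting_units e w ->
  exists a b, [/\ gen (lambda_up S e) a, gen (lambda_down S e) b & w = a * b].
Proof.
move=> Le; rewrite -gen_lambdaE //; apply: (_ : _ `<=` [set w | exists a b,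
  [/\ gen (lambda_up S e) a, gen (lambda_down S e) b & w = a * b]]).
apply: gen_min; first split.
- by exists 1, 1; rewrite mulg1; split=> //; apply: gen1.
- move=> _ _ [a [b [ga gb ->]]] [a' [b' [ga' gb' ->]]].
  exists (a * a'^-1), (b * b'^-1); split.
  + by apply: genM => //; apply: genV.
  + by apply: genM => //; apply: genV.
  have := lambda_up_down_commute Le (genV ga') (genM gb (genV gb')).
  by rewrite invgM -!mulgA => ->.
move=> s Is; have Ss := lambda_sub Le Is.
have se : commuting_units e s by rewrite -gen_lambdaE //; apply: gen_sub.
have [es|es] := pselect (e * uval s = e).
  exists 1, s; rewrite mul1g gen_lambda_downE //; split=> //; exact: gen1.
exists s, 1; rewrite mulg1; split=> //; last exact: gen1.
by apply: gen_sub.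
Qed.

Lemma gen_lambda_down_le e f w : Lam e -> Lam f -> idem_le e f ->
  gen (lambda_down S f) w -> gen (lambda_down S e) w.
Proof.
move=> Le Lf [ef fe]; rewrite !gen_lambda_downE // => -[wf fw].
have ew : e * uval w = e by rewrite -ef -mulgA fw.
by split=> //; rewrite ew; apply: idem_fix => //; apply: Lam_idem.
Qed.

Lemma gen_lambda_up_le e f w : Lam e -> Lam f -> idem_le e f ->
  gen (lambda_up S e) w -> gen (lambda_up S f) w.
Proof.
move=> Le Lf ef gw; move: w gw; apply: gen_min; first exact: gen_subgroup.
by move=> s /(grc_lambda_up grc Le Lf ef); apply: gen_sub.
Qed.

Lemma min_right_lambda_down e y : Lam e ->
  min_right S (lambda S e) y -> min_right S (lambda_down S e) y.
Proof.
move=> Le /min_rightP m; apply/min_rightP => x gx; apply: m; move: gx.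
by rewrite gen_lambdaE // gen_lambda_downE //; apply: fixing_commuting.
Qed.

(** * The adherence order on triples *)

Definition standard_triple x e y : Prop :=
  [/\ Lam e, min_left S (lambda_down S e) x & min_right S (lambda S e) y].

Definition triple_le x e y a f b : Prop :=
  idem_le e f /\
  exists w, [/\ prod_set (gen (lambda_up S f)) (gen (lambda_down S e)) w,
                bruhat S x (a * w) & bruhat S (w^-1 * b) y].

Lemma idem_le_refl e : Lam e -> idem_le e e.
Proof. by move=> /Lam_idem. Qed.

Lemma triple_le_refl x e y : standard_triple x e y -> triple_le x e y x e y.
Proof.
case=> Le _ _; split; first exact: idem_le_refl.
exists 1; rewrite invg1 mulg1 mul1g; split; try exact: bruhat_refl.
by exists 1; [apply: gen1|exists 1; [apply: gen1|rewrite mulg1]].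
Qed.

Lemma idem_le_anti e f : idem_le e f -> idem_le f e -> e = f.
Proof. by move=> [ef _] [_ fe]; apply: etrans fe. Qed.

(** Once [e = f], both [w] and [v] lie in the group of [lambda S e]. Minimality of [y] and [b] in
    their cosets gives [y = b], then [w = v = 1], and the first components compare directly. *)
Lemma triple_le_anti x e y a f b :
  standard_triple x e y -> standard_triple a f b ->
  triple_le x e y a f b -> triple_le a f b x e y -> [/\ x = a, e = f & y = b].
Proof.
move=> [Le mx my] [Lf ma mb] [ef [w [gw xa by_]]] [fe [v [gv ax yb]]].
have e_f := idem_le_anti ef fe; subst f.
have cw z : prod_set (gen (lambda_up S e)) (gen (lambda_down S e)) z ->
    gen (lambda S e) z.
  move=> [z1 g1 [z2 g2 <-]]; apply: genM.
    by rewrite gen_lambdaE //; apply: gen_lambda_up_commuting.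
  by move: g2; rewrite gen_lambdaE // gen_lambda_downE //; apply: fixing_commuting.
have {}gw := genV (cw _ gw); have {}gv := genV (cw _ gv).
have mb' := (min_rightP _ _ _).1 mb _ gw; have my' := (min_rightP _ _ _).1 my _ gv.
have yb' : y = b.
  apply: (@bruhat_anti _ S); first exact: bruhat_trans yb.
  exact: bruhat_trans by_.
subst b.
have w1 : w = 1.
  by apply: (can_inj invgK); rewrite invg1; apply: (mulIg y); rewrite mul1g;
    apply: (@bruhat_anti _ S).
have v1 : v = 1.
  by apply: (can_inj invgK); rewrite invg1; apply: (mulIg y); rewrite mul1g;
    apply: (@bruhat_anti _ S).
move: xa ax; rewrite w1 v1 !mulg1 => xa ax; split=> //.
exact: bruhat_anti xa ax.
Qed.

Lemma triple_le_trans x e y a f b c g d :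
  standard_triple x e y -> standard_triple a f b -> standard_triple c g d ->
  triple_le x e y a f b -> triple_le a f b c g d -> triple_le x e y c g d.
Proof.
move=> [Le mx my] [Lf ma mb] [Lg mc md].
move=> [ef [_ [[w1 gw1 [w2 gw2 <-]] xa by_]]] [fg [v [[v1 gv1 [v2 gv2 ev]] ac db]]].
have [ef1 ef2] := ef; have [fg1 fg2] := fg.
split; first by split; [rewrite -ef1 -mulgA fg1|rewrite -ef2 mulgA fg2].
have mb' : min_right S (lambda_up S f) b.
  apply/min_rightP => z gz; apply: ((min_rightP _ _ _).1 mb).
  by rewrite gen_lambdaE //; apply: gen_lambda_up_commuting.
have [w' [gw' aw bw]] := bruhat_mul_twist cox (@lambda_up_sub f) mb' ac db gw1.
have eS := lambda_down_sub Le.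
have [z [gz mz]] := min_right_exists cox eS (w'^-1 * (v^-1 * d)).
exists (v * (w' * z^-1)); split.
(* Here [v * w' * z^-1 = (v1 * w') * (v2 * z^-1)], since [v2] and [w'] commute. As [e <= f <= g],
   [w'] passes to the group of [lambda_up g] and [v2] to that of [lambda_down e]. *)
- exists (v1 * w'); first by apply: genM => //; apply: gen_lambda_up_le gw'.
  exists (v2 * z^-1).
    by apply: genM (genV gz); apply: gen_lambda_down_le gv2.
  rewrite -ev -!mulgA; congr (_ * _); rewrite !mulgA; congr (_ * _).
  exact: lambda_up_down_commute gw' gv2.
- rewrite !mulgA; apply: (min_left_le_mul cox eS mx _ (genV gz)).
  apply: bruhat_trans aw; rewrite -[a * w1](mulgK w2) -(mulgA a).
  exact: (min_left_le_mul cox eS mx xa (genV gw2)).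
- rewrite !invgM invgK -!mulgA.
  apply: bruhat_trans by_; rewrite invgM -mulgA.
  apply: (min_right_le_mul cox eS mz _ (genV gw2)).
  apply: bruhat_trans bw.
  by have := (min_rightP _ _ _).1 mz _ (genV gz); rewrite mulKg.
Qed.


(* The right standard form y e x of r is encoded by the triple (x^-1, e, y^-1), which
   turns the order [adherence_minus] into the same order on triples as [adherence_plus]. *)
Definition standard_form eps r x e y : Prop :=
  match eps with
  | Plus => left_standard_form Lam S r x e y
  | Minus => right_standard_form Lam S r y^-1 e x^-1
  end.

Lemma standard_form_triple eps r x e y :
  standard_form eps r x e y -> standard_triple x e y.
Proof.
case: eps => -[_ Le m1 m2] //; split=> //.
  exact/(min_leftV _ cox).
by move: m1; rewrite (min_leftV _ cox) invgK.
Qed.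

Lemma standard_form_inj eps r s x e y :
  standard_form eps r x e y -> standard_form eps s x e y -> r = s.
Proof. by case: eps => -[-> _ _ _] [-> _ _ _]. Qed.

(** * Existence and uniqueness of standard forms *)

Lemma unit_idem_unit r : exists u e v, Lam e /\ r = uval u * e * uval v.
Proof.
have [e' ie' [w ->]] := grc_factor_EW grc r.
have [e [[Le [u ue]] _]] := grc_transversal grc ie'.
by exists u^-1, e, (u * w); split=> //; rewrite (conj_byK ue) uvalM !mulgA.
Qed.

(** In [u e v], the factor [c] making [c * v] minimal is compensated by [c^-1] on the left, since
    [c] commutes with [e]; afterwards [d] may be inserted because [e] absorbs it. *)
Lemma left_standard_form_exists r : exists x e y, left_standard_form Lam S r x e y.
Proof.
have [u [e [v [Le ->]]]] := unit_idem_unit r.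
have [c [gc my]] := min_right_exists cox (lambda_sub Le) v.
have [d [gd mx]] := min_left_exists cox (lambda_down_sub Le) (u * c^-1).
exists (u * c^-1 * d), e, (c * v); split=> //.
have {}gc : commuting_units e c by rewrite -gen_lambdaE.
have [de ed] : fixing_units e d by rewrite -gen_lambda_downE.
rewrite !uvalM -!mulgA (mulgA (uval d)) de ed (mulgA e) -gc -mulgA.
by rewrite uvalVK.
Qed.

Lemma right_standard_form_exists r : exists y e x, right_standard_form Lam S r y e x.
Proof.
have [u [e [v [Le ->]]]] := unit_idem_unit r.
have [c [gc my]] := min_left_exists cox (lambda_sub Le) u.
have [d [gd mx]] := min_right_exists cox (lambda_down_sub Le) (c^-1 * v).
exists (u * c), e, (d * (c^-1 * v)); split=> //.
have {}gc : commuting_units e c by rewrite -gen_lambdaE.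
have [de ed] : fixing_units e d by rewrite -gen_lambda_downE.
rewrite !uvalM -!mulgA (mulgA e (uval d)) ed (mulgA (uval c) e) gc -mulgA.
by rewrite uvalK.
Qed.

Lemma standard_form_exists eps r : exists x e y, standard_form eps r x e y.
Proof.
case: eps; first exact: left_standard_form_exists.
have [y [e [x h]]] := right_standard_form_exists r.
by exists x^-1, e, y^-1; rewrite /= !invgK.
Qed.

(** The outer factor is settled first: [y' * y^-1] commutes with [e], so it is 1. Only then does
    [x^-1 * x'] fall in the smaller fixing group, where minimality of [x] applies. *)
Lemma left_standard_form_uniq r x e y x' e' y' :
  left_standard_form Lam S r x e y -> left_standard_form Lam S r x' e' y' ->
  [/\ x = x', e = e' & y = y'].
Proof.
move=> [-> Le mx my] [h Le' mx' my'].
have [ee cx fxy] := double_coset_uniq Le Le' h; subst e'.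
have cy : commuting_units e (y' * y^-1).
  move: (fixing_commuting fxy) cx; rewrite -!gen_lambdaE // => g1 g2.
  by have := genM (genV g2) g1; rewrite mulKg.
have yy : y' * y^-1 = 1.
  apply: (min_right_uniq my); first by rewrite mulgVK.
  by rewrite gen_lambdaE.
have xx : x^-1 * x' = 1.
  apply: (min_left_uniq cox mx); first by rewrite mulVKg.
  by rewrite gen_lambda_downE //; move: fxy; rewrite yy mulg1.
split=> //; first by apply: (mulgI x^-1); rewrite xx mulVg.
by apply: (mulIg y^-1); rewrite yy mulgV.
Qed.

Lemma right_standard_form_uniq r y e x y' e' x' :
  right_standard_form Lam S r y e x -> right_standard_form Lam S r y' e' x' ->
  [/\ y = y', e = e' & x = x'].
Proof.
move=> [-> Le my mx] [h Le' my' mx'].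
have [ee cy fxy] := double_coset_uniq Le Le' h; subst e'.
have yy : y^-1 * y' = 1.
  apply: (min_left_uniq cox my); first by rewrite mulVKg.
  by rewrite gen_lambdaE.
have xx : x' * x^-1 = 1.
  apply: (min_right_uniq mx); first by rewrite mulgVK.
  by rewrite gen_lambda_downE //; move: fxy; rewrite yy mul1g.
split=> //; first by apply: (mulgI y^-1); rewrite yy mulVg.
by apply: (mulIg x^-1); rewrite xx mulgV.
Qed.

Lemma standard_form_uniq eps r x e y x' e' y' :
  standard_form eps r x e y -> standard_form eps r x' e' y' ->
  [/\ x = x', e = e' & y = y'].
Proof.
case: eps; first exact: left_standard_form_uniq.
by move=> h /(right_standard_form_uniq h)[/invg_inj -> -> /invg_inj ->].
Qed.

Lemma adherence_formP eps r s : adherence Lam S eps r s <->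
  exists x e y a f b, [/\ standard_form eps r x e y, standard_form eps s a f b
    & triple_le x e y a f b].
Proof.
case: eps => /=; split.
- move=> [x [e [y [a [f [b [h1 h2 ef h]]]]]]].
  by exists x, e, y, a, f, b.
- move=> [x [e [y [a [f [b [h1 h2 [ef h]]]]]]]].
  by exists x, e, y, a, f, b.
- move=> [y [e [x [b [f [a [h1 h2 ef [_ [[w1 g1 [w2 g2 <-]] xa by_]]]]]]]]].
  exists x^-1, e, y^-1, a^-1, f, b^-1; rewrite !invgK; split=> //; split=> //.
  exists (w1 * w2)^-1; split.
  + by rewrite invgM; exists w2^-1; [apply: genV|exists w1^-1; [apply: genV|]].
  + by rewrite -invgM; apply: bruhatV.
  + by rewrite -invgM; apply: bruhatV.
- move=> [x [e [y [a [f [b [h1 h2 [ef [_ [[w1 g1 [w2 g2 <-]] xa by_]]]]]]]]]].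
  exists y^-1, e, x^-1, b^-1, f, a^-1; split=> //.
  exists (w1 * w2)^-1; split.
  + by rewrite invgM; exists w2^-1; [apply: genV|exists w1^-1; [apply: genV|]].
  + by rewrite -invgM; apply: bruhatV.
  + by rewrite -invgM; apply: bruhatV.
Qed.

Lemma adherence_form eps r s x e y a f b :
  standard_form eps r x e y -> standard_form eps s a f b ->
  (adherence Lam S eps r s <-> triple_le x e y a f b).
Proof.
move=> hr hs; rewrite adherence_formP; split=> [|h]; last first.
  by exists x, e, y, a, f, b.
move=> [x' [e' [y' [a' [f' [b' [hr' hs']]]]]]].
have [-> -> ->] := standard_form_uniq hr hr'.
by have [-> -> ->] := standard_form_uniq hs hs'.
Qed.

Lemma adherence_order eps : Relation_Definitions.order R (adherence Lam S eps).
Proof.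
split.
- move=> r; have [x [e [y h]]] := standard_form_exists eps r.
  by apply/(adherence_form h h)/triple_le_refl/(standard_form_triple h).
- move=> r s t; have [x [e [y hr]]] := standard_form_exists eps r.
  have [a [f [b hs]]] := standard_form_exists eps s.
  have [c [g [d ht]]] := standard_form_exists eps t.
  move=> /(adherence_form hr hs) rs /(adherence_form hs ht) st.
  apply/(adherence_form hr ht).
  exact: triple_le_trans (standard_form_triple hr) (standard_form_triple hs)
    (standard_form_triple ht) rs st.
- move=> r s; have [x [e [y hr]]] := standard_form_exists eps r.
  have [a [f [b hs]]] := standard_form_exists eps s.
  move=> /(adherence_form hr hs) rs /(adherence_form hs hr) sr.
  have [ex ee ey] := triple_le_anti (standard_form_triple hr) (standard_form_triple hs) rs sr.
  by apply: (standard_form_inj hr); rewrite ex ee ey.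
Qed.

(** * Restriction to the group of units *)

Lemma Lam1 : Lam 1.
Proof.
have i1 : idempotents (1 : R) by rewrite /idempotents /= mulg1.
have [e [[Le [w we]] _]] := grc_transversal grc i1.
suff -> : 1 = e by [].
by rewrite -we; apply/esym/commuting_conj; rewrite /commuting_units /= mulg1 mul1g.
Qed.

Lemma min_left_lambda_down1 u : min_left S (lambda_down S 1) u.
Proof.
apply/min_leftP => x; rewrite gen_lambda_downE; last exact: Lam1.
move=> [_]; rewrite mul1g => /(@uval_inj R x 1) ->.
by rewrite mulg1; apply: bruhat_refl.
Qed.

(** Every unit commutes with 1 and only the trivial one fixes it, so the whole unit sits in the
    first component; the sign [Minus] inverts it because of the encoding of right forms. *)
Lemma standard_form_unit eps u :
  standard_form eps (uval u) (if eps is Plus then u else u^-1) 1 1.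
Proof.
have L1 := Lam1.
case: eps => /=; split=> //; rewrite ?invg1 ?invgK ?uval1 ?mulg1 ?mul1g //.
- exact: min_left_lambda_down1.
- exact: (min_right1 cox (lambda_sub L1)).
- by apply/(min_leftV _ cox); rewrite invg1; exact: (min_right1 cox (lambda_sub L1)).
- by rewrite -[u]invgK; apply/(min_leftV _ cox); apply: min_left_lambda_down1.
Qed.

Lemma triple_le1 u v : triple_le u 1 1 v 1 1 <-> bruhat S u v.
Proof.
split=> [[_ [w [_ uv w1]]]|uv]; last first.
  split; first by apply: idem_le_refl; apply: Lam1.
  exists 1; rewrite invg1 !mulg1; split=> //; last exact: bruhat_refl.
  by exists 1; [apply: gen1|exists 1; [apply: gen1|rewrite mulg1]].
(* The second inequality reads [w^-1 <= 1], and 1 is the Bruhat minimum of the whole group. *)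
have w11 : w^-1 = 1.
  rewrite mulg1 in w1; apply: (bruhat_anti w1).
  have := (min_rightP _ _ _).1 (min_right1 cox (@subset_refl _ S)) w^-1.
  by rewrite mulg1; apply; apply: gen_full.
by move: uv; rewrite -[w]invgK w11 invg1 mulg1.
Qed.

Lemma adherence_unit eps u v :
  bruhat S u v <-> adherence Lam S eps (uval u) (uval v).
Proof.
rewrite (adherence_form (standard_form_unit eps u) (standard_form_unit eps v)).
rewrite triple_le1; case: eps => //; split=> /(bruhatV cox) //.
by rewrite !invgK.
Qed.

(** * Restriction to idempotents *)

Lemma idem_conj_form p : idempotents p -> exists e y,
  [/\ Lam e, min_right S (lambda S e) y & p = uval y^-1 * e * uval y].
Proof.
move=> ip; have [e [[Le [w we]] _]] := grc_transversal grc ip.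
have [c [gc my]] := min_right_exists cox (lambda_sub Le) w.
exists e, (c * w); split=> //.
have {}gc : commuting_units e c by rewrite -gen_lambdaE.
by rewrite (conj_byK we) invgM !uvalM -!mulgA (mulgA e) -gc -mulgA uvalVK.
Qed.

Lemma standard_form_idem eps e y : Lam e -> min_right S (lambda S e) y ->
  standard_form eps (uval y^-1 * e * uval y) y^-1 e y.
Proof.
move=> Le my; have md := min_right_lambda_down Le my.
by case: eps; split=> //; rewrite ?invgK //; apply/(min_leftV _ cox); rewrite invgK.
Qed.

Lemma conj_by_le e f w : idem_le e f -> idem_le (conj_by w e) (conj_by w f).
Proof.
by move=> [ef fe]; split; rewrite /conj_by -!mulgA uvalVK; rewrite (mulgA _ _ (uval _))
  ?ef ?fe.
Qed.

Lemma triple_le_idem e y f b : Lam e -> Lam f ->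
  min_right S (lambda S e) y -> min_right S (lambda S f) b ->
  triple_le y^-1 e y b^-1 f b <->
  idem_le (uval y^-1 * e * uval y) (uval b^-1 * f * uval b).
Proof.
move=> Le Lf my mb; split.
- move=> [ef [_ [[w1 g1 [w2 g2 <-]] /(bruhatV cox) h1 h2]]].
  move: h1 h2; rewrite invgM !invgK => h1 h2.
  (* Inverting the first inequality makes the two opposite, so [y = (w1 * w2)^-1 * b]. Since [w2]
     commutes with [e] and [w1] with [f], the single unit [b^-1 * w1] conjugates [e] and [f] to the
     two idempotents. *)
  have ey := bruhat_anti h1 h2.
  have ew2 : conj_by w2 e = e.
    apply/commuting_conj/fixing_commuting; by rewrite -gen_lambda_downE.
  have fw1 : conj_by w1 f = f.
    by apply/commuting_conj/gen_lambda_up_commuting.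
  have -> : uval y^-1 * e * uval y = conj_by (b^-1 * w1) e.
    by rewrite -{2}ew2 ey /conj_by !invgM !invgK !uvalM !mulgA.
  have -> : uval b^-1 * f * uval b = conj_by (b^-1 * w1) f.
    by rewrite -{1}fw1 /conj_by invgM invgK !uvalM !mulgA.
  exact: conj_by_le.
- set p := uval y^-1 * e * _; set q := uval b^-1 * f * _ => pq.
  have ip : idempotents p.
    by rewrite /p -{2}[y]invgK; apply: conj_by_idem; apply: Lam_idem.
  have iq : idempotents q.
    by rewrite /q -{2}[b]invgK; apply: conj_by_idem; apply: Lam_idem.
  have [w [e0 [f0 [Le0 Lf0 ef we wf]]]] := grc_conj_pairs grc ip iq pq.
  have we' : uval 1 * e0 * uval 1 = uval (w * y^-1) * e * uval (y * w^-1).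
    by rewrite !uval1 mul1g mulg1 -we /p /conj_by !uvalM !mulgA.
  have wf' : uval 1 * f0 * uval 1 = uval (w * b^-1) * f * uval (b * w^-1).
    by rewrite !uval1 mul1g mulg1 -wf /q /conj_by !uvalM !mulgA.
  have [ee ce _] := double_coset_uniq Le0 Le we'.
  have [ff cf _] := double_coset_uniq Lf0 Lf wf'.
  rewrite invg1 mul1g ee in ce; rewrite invg1 mul1g ff in cf; rewrite ee ff in ef.
  split=> //.
  (* With this witness both inequalities are equalities. Its shape comes from the simultaneous
     conjugator [w]: [b * w^-1] commutes with [f] and [w * y^-1] with [e]. Both are decomposed and
     the middle factors swapped. *)
  exists (b * y^-1); split; last 2 first.
  + by rewrite mulKg; apply: bruhat_refl.
  + by rewrite invgM invgK mulgVK; apply: bruhat_refl.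
  have {}cf : commuting_units f (b * w^-1).
    by move: cf; rewrite -gen_lambdaE // => /genV; rewrite invgM invgK.
  have [c1 [c2 [gc1 gc2 ec]]] := commuting_decomp Lf cf.
  have [d1 [d2 [gd1 gd2 ed]]] := commuting_decomp Le ce.
  have {}gc2 := gen_lambda_down_le Le Lf ef gc2.
  exists (c1 * d1).
    by apply: genM => //; apply: gen_lambda_up_le gd1.
  exists (c2 * d2); first exact: genM.
  rewrite -mulgA (mulgA d1) (lambda_up_down_commute Le gd1 gc2) -mulgA -ed mulgA.
  by rewrite -ec mulgA mulgVK.
Qed.

Lemma adherence_idem eps p q : idempotents p -> idempotents q ->
  (idem_le p q <-> adherence Lam S eps p q).
Proof.
move=> /idem_conj_form[e [y [Le my ->]]] /idem_conj_form[f [b [Lf mb ->]]].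
rewrite -triple_le_idem //.
by rewrite (adherence_form (standard_form_idem eps Le my) (standard_form_idem eps Lf mb)).
Qed.

End RennerCoxeter.

Theorem theorem3p5 (R : monoidType) (Lam : set R) (S : set (units R))
    (eps : sign) :
  generalized_renner_coxeter Lam S ->
  [/\ Relation_Definitions.order R (adherence Lam S eps),
      (forall u v : units R,
         bruhat S u v <-> adherence Lam S eps (uval u) (uval v)),
      (forall e f : R, Lam e -> Lam f ->
         (idem_le e f <-> adherence Lam S eps e f))
    & (forall e f : R, idempotents e -> idempotents f ->
         (idem_le e f <-> adherence Lam S eps e f))].
Proof.
move=> grc; split.
- exact: adherence_order.
- by move=> u v; apply: adherence_unit.
- by move=> e f /(grc_Lam_idem grc) ie /(grc_Lam_idem grc) jf; apply: adherence_idem.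
- by move=> e f; apply: adherence_idem.
Qed.
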